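(* Let $U$ be a countably infinite set and $\mathrm{G}$ a subgroup of $\mathfrak{S}(U)$. A subset $C$ of $U$ belongs to $\overline{\mathrm{G}}[U]$ if and only if for every finite subset $F$ of $C$ and every $x\in U\setminus F$ there is $g\in\mathrm{G}\langle F\rangle$ such that $g(x)\in C$.
   Context: $\overline{\mathrm{G}}$ is the closure of $\mathrm{G}$ in $U^U$ for the function topology: the set of maps $f:U\to U$ such that for every finite $E\subseteq U$ some $g\in\mathrm{G}$ agrees with $f$ on $E$. $\overline{\mathrm{G}}[U]=\{f[U]\mid f\in\overline{\mathrm{G}}\}$ is the set of copies. For $F\subseteq U$, $\mathrm{G}\langle F\rangle=\{g\in\mathrm{G}\mid g(x)=x\ \forall x\in F\}$. *)

(* Defs.v *)
From HB Require Import structures.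
From mathcomp Require Import all_boot finmap.
From mathcomp Require Import boolp classical_sets functions cardinality filter.
From mathcomp Require Import topology.

Set Implicit Arguments.
Unset Strict Implicit.
Unset Printing Implicit Defensive.

Local Open Scope classical_set_scope.

Definition Sym (U : Type) : set (U -> U) := [set g | bijective g].
Arguments Sym : clear implicits.

Record subgroup_of_Sym (U : Type) (G : set (U -> U)) : Prop := SubgroupOfSym {
  subgroup_sub : G `<=` Sym U;
  subgroup_id : G id;
  subgroup_comp : forall g h, G g -> G h -> G (g \o h);
  subgroup_inv : forall g h, G g -> cancel g h -> cancel h g -> G h }.

Definition fun_closure (U : Type) (G : set (U -> U)) : set (U -> U) :=
  [set f | forall E : set U, finite_set E ->
     exists2 g, G g & forall x, E x -> g x = f x].

(* This is the topological closure in U^U, where U is discrete. *)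
Lemma fun_closureE (U : choiceType) (G : set (U -> U)) :
  fun_closure G = closure (G : set {ptws U -> discrete_topology U}).
Proof.
apply/seteqP; split => f.
- move=> Gf B.
  pose agree (E : set U) := [set g : U -> U | forall x, E x -> g x = f x].
  pose Fl := filter_from (@finite_set U) agree.
  have FlF : Filter Fl.
    apply: filter_from_filter; first by exists set0.
    move=> E1 E2 fE1 fE2; exists (E1 `|` E2); first by rewrite finite_setU.
    by move=> g gE; split=> x Ex; apply: gE; [left|right].
  have Flf : Fl --> (f : {ptws U -> discrete_topology U}).
    apply/cvg_sup => x A [_ [[O _ <-] Of OA]].
    exists [set x]; first exact: finite_set1.
    by move=> g gf; apply: OA; rewrite /= gf.
  move=> /Flf[E fE EB]; have [g Gg gf] := Gf E fE.
  by exists g; split => //; exact: EB.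
- move=> clf _ /finite_fsetP[E ->].
  pose A (x : U) : set {ptws U -> discrete_topology U} := [set g | g x = f x].
  have : nbhs (f : {ptws U -> discrete_topology U}) (\bigcap_(x in [set` E]) A x).
    apply: filter_bigI => x _.
    have := @proj_continuous U (fun=> discrete_topology U) x f [set f x].
    by move=> /(_ (@discrete_set1 (discrete_topology U) (f x))).
  by move=> /clf[g [Gg gA]]; exists g.
Qed.

Definition copies (U : Type) (G : set (U -> U)) : set (set U) :=
  [set range f | f in fun_closure G].

Definition pointwise_stabilizer (U : Type) (G : set (U -> U)) (F : set U) :
    set (U -> U) :=
  [set g | G g /\ forall x, F x -> g x = x].

(* Main.v *)
(** If [f] is in the closure and [C = range f], choose [g] and then [h] in [G]
    agreeing with [f] on a finite set mapped onto [F] and, for [h], also at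
    [g^-1 x]; then [h \o g^-1] fixes [F] pointwise and sends [x] into [C].
    Conversely, a back-and-forth along an enumeration of [U] builds [f] as the
    union of increasing finite restrictions of elements of [G] with values
    in [C]: to extend [g] on [E] to a point [u], apply the hypothesis to
    [F = g @` E] and [x = g u]; to reach a value [c] in [C], add [g^-1 c]
    to [E]. *)
Require Import Defs.
From mathcomp Require Import all_boot.
From mathcomp Require Import boolp classical_sets functions cardinality.

Local Open Scope classical_set_scope.
Local Open Scope card_scope.

Lemma finite_preimages {T U : Type} {f : T -> U} {F : set U} :
  finite_set F -> F `<=` range f ->
  exists2 E : set T, finite_set E & f @` E = F.
Proof.
(* [T] may be empty, so [F = set0] is treated apart; otherwise a point of [F] yields [x0], the
   default value off [F] of the section [k]. *)
move=> finF Ff; have [->|/set0P[y0 Fy0]] := eqVneq F set0.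
  by exists set0; rewrite ?image_set0.
have [x0 _ _] := Ff _ Fy0.
have /choice[k fk] y : exists x, F y -> f x = y.
  have [/Ff[x _ fx]|nFy] := pselect (F y); first by exists x.
  by exists x0.
exists (k @` F); first exact: finite_image.
rewrite image_comp; apply/seteqP; split=> [_ [y Fy <-]|y Fy].
  by rewrite /= fk.
by exists y => //=; rewrite fk.
Qed.

Lemma finite_set_nat_bounded {A : set nat} :
  finite_set A -> exists n, forall m, A m -> m < n.
Proof.
case/finite_seqP=> s ->; exists (\max_(i <- s) i).+1 => m /= sm.
by rewrite ltnS; apply: leq_bigmax_seq.
Qed.

Lemma countably_infinite_enum {U : Type} : [set: U] #= [set: nat] ->
  exists (e : nat -> U) (r : U -> nat), cancel r e.
Proof.
move=> /card_set_bijP[r [_ rinj rsurj]].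
have /choice[e eK] n : exists u, r u = n.
  by have [u _ ru] := rsurj n I; exists u.
by exists e, r => u; apply: rinj; rewrite ?inE ?eK.
Qed.

Section Copies.
Context {U : Type} {G : set (U -> U)} (subG : subgroup_of_Sym G).
Variable C : set U.

Definition movable_into := forall F : set U, finite_set F -> F `<=` C ->
  forall x : U, (~` F) x -> exists2 g, pointwise_stabilizer G F g & C (g x).

Lemma subgroup_inverse {g} : G g ->
  exists2 h, G h & cancel g h /\ cancel h g.
Proof.
move=> Gg; have [h gK hK] := subgroup_sub subG Gg.
by exists h => //; exact: (subgroup_inv subG Gg).
Qed.

Lemma copies_movable_into : copies G C -> movable_into.
Proof.
move=> [f Gf Cf] F finF; rewrite -Cf => Ff x _.
have [E finE fE] := finite_preimages finF Ff.
have [g Gg gf] := Gf E finE.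
have [g' Gg' [gK g'K]] := subgroup_inverse Gg.
have finEx : finite_set (E `|` [set g' x]).
  by rewrite finite_setU; split=> //; exact: finite_set1.
have [h Gh hf] := Gf _ finEx.
exists (h \o g'); last by exists (g' x) => //=; rewrite hf //; right.
split; first exact: (subgroup_comp subG).
rewrite -fE => _ [y Ey <-] /=.
(* Since [f y = g y], the inverse [g'] sends [f y] back to [y], where [h] again takes the value
   [f y]. *)
by rewrite -[in LHS](gf _ Ey) gK hf //; left.
Qed.

(** A pair [(g, E)] encodes the finite partial map [g] restricted to [E]; values of [g] off [E] may
    change at later stages. *)
Definition partial_copy (s : (U -> U) * set U) :=
  [/\ G s.1, finite_set s.2 & s.1 @` s.2 `<=` C].

Definition extends (s t : (U -> U) * set U) :=
  s.2 `<=` t.2 /\ forall x, s.2 x -> t.1 x = s.1 x.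

Lemma extends_refl s : extends s s.
Proof. by split. Qed.

Lemma extends_trans {s t v} : extends s t -> extends t v -> extends s v.
Proof.
move=> [st stE] [tv tvE]; split=> [x /st/tv //|x sx].
by rewrite tvE ?stE //; exact: st.
Qed.

Lemma partial_copy_forth {s} (u : U) : movable_into -> partial_copy s ->
  exists t, [/\ partial_copy t, extends s t & t.2 u].
Proof.
case: s => g E CP [/= Gg finE gE].
have finEu : finite_set (E `|` [set u]).
  by rewrite finite_setU; split=> //; exact: finite_set1.
have [gEu|ngEu] := pselect ((g @` E) (g u)).
  exists (g, E `|` [set u]); split; last by right.
    split=> // _ [x [Ex|->] <-]; apply: gE => //.
    by exists x.
  by split=> //= x; left.
have [h [Gh hgE] Chgu] := CP _ (finite_image g finE) gE _ ngEu.
have hg x : E x -> h (g x) = g x by move=> Ex; apply: hgE; exists x.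
exists (h \o g, E `|` [set u]); split; last by right.
  split=> //=; first exact: (subgroup_comp subG).
  by move=> _ [x [Ex|->] <-] //=; rewrite hg //; apply: gE; exists x.
by split=> //= x; left.
Qed.

(** Surjectivity of [g] lets the domain grow without changing [g]. Guarding the last clause by [C c]
    allows one enumeration of [U] to serve both directions. *)
Lemma partial_copy_back {s} (c : U) : partial_copy s ->
  exists t, [/\ partial_copy t, extends s t & C c -> (t.1 @` t.2) c].
Proof.
case: s => g E sP; have [/= Gg finE gE] := sP.
have [Cc|nCc] := pselect (C c); last first.
  by exists (g, E); split=> //; exact: extends_refl.
have [g' _ [_ g'K]] := subgroup_inverse Gg.
exists (g, E `|` [set g' c]); split.
- split=> //=.
    by rewrite finite_setU; split=> //; exact: finite_set1.
  by move=> _ [x [Ex|->] <-]; [apply: gE; exists x | rewrite g'K].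
- by split=> //= x; left.
- by exists (g' c); [right | rewrite /= g'K].
Qed.

Lemma partial_copy_limit {e : nat -> U} {r : U -> nat}
    {s : nat -> (U -> U) * set U} :
    cancel r e -> (forall n, partial_copy (s n)) ->
    (forall n, extends (s n) (s n.+1)) ->
    (forall n, (s n.+1).2 (e n)) ->
    (forall n, C (e n) -> ((s n.+1).1 @` (s n.+1).2) (e n)) ->
  copies G C.
Proof.
move=> rK sP sS s_dom s_val.
have s_ext m n : m <= n -> extends (s m) (s n).
  elim: n => [|n IHn]; first by rewrite leqn0 => /eqP->; exact: extends_refl.
  rewrite leq_eqVlt => /predU1P[->|/IHn mn]; first exact: extends_refl.
  exact: extends_trans mn (sS n).
have s_at x : (s (r x).+1).2 x by have := s_dom (r x); rewrite rK.
(* Stage [(r x).+1] has [x = e (r x)] in its domain, and by coherence any other stage defined at [x]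
   gives the same value. *)
pose f x := (s (r x).+1).1 x.
have fE n x : (s n).2 x -> f x = (s n).1 x.
  rewrite /f => snx; have [le_n|/ltnW le_n] := leqP n (r x).+1.
    by have [_ ->] := s_ext _ _ le_n.
  by have [_ ->] := s_ext _ _ le_n.
exists f => [E finE|].
  (* Once [n] exceeds every index [r x] with [x] in [E], the single element [(s n).1] of [G] agrees
     with [f] on all of [E]. *)
  have [n En] := finite_set_nat_bounded (finite_image r finE).
  exists (s n).1 => [|x Ex]; first by have [] := sP n.
  have rxn : r x < n by apply: En; exists x.
  by have [_ ->] := s_ext _ _ rxn.
apply/seteqP; split=> [_ [x _ <-]|c Cc].
  by have [_ _] := sP (r x).+1; apply; exists x.
have [|x sx] := s_val (r c); rewrite rK // => xc.
by exists x => //; rewrite (fE _ _ sx).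
Qed.

Lemma movable_into_copies :
  [set: U] #= [set: nat] -> movable_into -> copies G C.
Proof.
move=> /countably_infinite_enum[e [r rK]] CP.
(* Placing the invariant under the existential makes [next] a total function, as the recursion
   defining [s] requires; the invariant is then proved by induction. *)
have /choice[next nextP] (ns : nat * ((U -> U) * set U)) : exists t,
    partial_copy ns.2 -> [/\ partial_copy t, extends ns.2 t,
      t.2 (e ns.1) & C (e ns.1) -> (t.1 @` t.2) (e ns.1)].
  case: ns => n s /=.
  have [sP|nsP] := pselect (partial_copy s); last by exists s.
  have [t [tP st tn]] := partial_copy_forth (e n) CP sP.
  have [v [vP tv vn]] := partial_copy_back (e n) tP.
  exists v => _; split=> //; first exact: extends_trans st tv.
  by have [tv2 _] := tv; exact: tv2.
pose s := nat_rect (fun=> ((U -> U) * set U)%type) (id, set0)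
  (fun n sn => next (n, sn)).
have sP n : partial_copy (s n).
  elim: n => [|n /(nextP (n, _))[] //]; split=> //=.
  - exact: subgroup_id subG.
  - by rewrite image_set0.
by apply: (partial_copy_limit rK sP) => n; have [] := nextP (n, s n) (sP n).
Qed.

End Copies.

Theorem theorem5p1 (U : Type) (U_countably_infinite : [set: U] #= [set: nat])
    (G : set (U -> U)) (G_subgroup : subgroup_of_Sym G) (C : set U) :
  copies G C <->
  (forall F : set U, finite_set F -> F `<=` C ->
     forall x : U, (~` F) x ->
       exists2 g, pointwise_stabilizer G F g & C (g x)).
Proof.
split; first exact: copies_movable_into.
exact: movable_into_copies.
Qed.
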